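(* There is an algorithm which, given a positive integer $n$ and any element $\sigma$ of the alternating group $A_n$, computes two $n$-cycles $\lambda_1, \lambda_2 \in S_n$ such that $\sigma = \lambda_1 \lambda_2$, in running time $O(n)$. (In particular, for every $n \ge 1$, every element of $A_n$ is a product of two $n$-cycles in $S_n$.)
   Context: $S_n$ is the symmetric group on $\{1, \dots, n\}$ and $A_n$ is its subgroup of even permutations. Products of permutations are compositions, with the right factor applied first. A $k$-cycle in $S_n$ is a permutation $(a_1, \dots, a_k)$ with $a_1, \dots, a_k$ distinct, sending $a_i \mapsto a_{i+1}$ for $i<k$, $a_k \mapsto a_1$, and fixing every other point; a $1$-cycle is the identity. Permutations are represented in cycle notation (the list of the disjoint cycles, one-element cycles included). Running time is the number of elementary steps in the unit-cost random access model, in which reading, writing, comparing and doing arithmetic on integers of size $O(n)$ each take constant time; $O(n)$ means at most $Cn$ with $C$ an absolute constant. *)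

(* Defs.v *)
From mathcomp Require Import all_boot all_fingroup all_solvable.
Set Implicit Arguments.
Unset Strict Implicit.
Unset Printing Implicit Defensive.

(* The points 1, ..., n are the elements of 'I_n, the point a being the
   ordinal of value a - 1.  [next c x] is the element following x cyclically
   in c, and is x itself when x is not in c. *)
Definition is_kcycle (n k : nat) (s : {perm 'I_n}) : Prop :=
  exists c : seq 'I_n, [/\ size c = k, uniq c & s =1 next c].

(* The order of the cycles and the starting point of each cycle are free. *)
Definition cycle_notation (n : nat) (cs : seq (seq 'I_n)) (s : {perm 'I_n}) :
    Prop :=
  [/\ perm_eq (flatten cs) (enum 'I_n),
      [::] \notin cs
    & forall c x, c \in cs -> x \in c -> s x = next c x].

(* A list of cycles as a word over {0, ..., n}: points are written as
   1, ..., n, and a 0 is written at the end of each cycle. *)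
Definition word (n : nat) (cs : seq (seq 'I_n)) : seq nat :=
  flatten [seq rcons [seq (val x).+1 | x <- c] 0 | c <- cs].

Inductive arith_op := Add | Sub | Mul | Div | Mod.

(* Sub is truncated; Div and Mod are Euclidean (Div by 0 gives 0). *)
Definition eval_op (o : arith_op) : nat -> nat -> nat :=
  match o with
  | Add => addn
  | Sub => subn
  | Mul => muln
  | Div => divn
  | Mod => modn
  end.

(* A unit-cost random access machine: R is the register file, M the memory.
   Registers are named by constants r, a, b of the program; the cells of the
   memory are addressed indirectly, by the contents of a register. *)
Inductive instr :=
  | Const (r k : nat)                   (* R[r] := k *)
  | Arith (o : arith_op) (r a b : nat)  (* R[r] := R[a] o R[b] *)
  | Read (r a : nat)                    (* R[r] := M[R[a]] *)
  | Write (a r : nat)                   (* M[R[a]] := R[r] *)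
  | JumpLt (a b l : nat)                (* if R[a] < R[b] then goto l *)
  | JumpEq (a b l : nat)                (* if R[a] = R[b] then goto l *)
  | Halt.

Definition program := seq instr.

Record config := Config { pc : nat; reg : nat -> nat; cell : nat -> nat }.

Definition upd (f : nat -> nat) (i v : nat) : nat -> nat :=
  fun j => if j == i then v else f j.

(* Running past the end of the program halts. *)
Definition fetch (P : program) (c : config) : instr := nth Halt P (pc c).

Definition step (P : program) (c : config) : config :=
  let: Config p R M := c in
  match fetch P c with
  | Const r k => Config p.+1 (upd R r k) M
  | Arith o r a b => Config p.+1 (upd R r (eval_op o (R a) (R b))) M
  | Read r a => Config p.+1 (upd R r (M (R a))) M
  | Write a r => Config p.+1 R (upd M (R a) (R r))
  | JumpLt a b l => Config (if R a < R b then l else p.+1) R M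
  | JumpEq a b l => Config (if R a == R b then l else p.+1) R M
  | Halt => c
  end.

Definition halted (P : program) (c : config) : Prop := fetch P c = Halt.

(* In particular only addresses at most B are ever used. *)
Definition bounded (B : nat) (c : config) : Prop :=
  (forall i, reg c i <= B) /\ (forall i, cell c i <= B).

(* From c, the program P halts in c' after at most T elementary steps, and no
   integer exceeding B occurs in any configuration on the way. *)
Definition halts_within (P : program) (T B : nat) (c c' : config) : Prop :=
  exists t, [/\ t <= T, iter t (step P) c = c', halted P c'
             & forall i, i <= t -> bounded B (iter i (step P) c)].

(* R[0] = n, the word w is in the memory from address 0 on, and all other
   registers and memory cells are 0. *)
Definition init_config (n : nat) (w : seq nat) : config :=
  Config 0 (upd (fun=> 0) 0 n) (nth 0 w).

Definition output (c : config) (w : seq nat) : Prop :=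
  forall i, i < size w -> cell c i = nth 0 w i.

(* Main.v *)
Require Import Defs.
From mathcomp Require Import all_boot all_fingroup all_solvable.
From mathcomp Require Import zify.
Set Implicit Arguments.
Unset Strict Implicit.
Unset Printing Implicit Defensive.

(* Read the cycles of sigma point by point, keeping two cycles A and B on the
   points read so far, together with a dummy fixed point 0 of sigma, such that
   A (B s) = sigma s. Inserting x after 0 in B and after B 0 in A makes x a
   fixed point of A \o B. Inserting p, q after z in B and after w = B z' in A
   (z -> p -> q and w -> p -> q) amounts to inserting p after z' and then q
   after z in A \o B. So a point that extends the current cycle waits until the
   next such point arrives, whether in the same cycle or in a later one, and
   both are then inserted at once. Since sigma is even, no point is left
   waiting at the end. Deleting 0 from both cycles leaves the product unchanged
   on the other points, and reading A and B from 0 until 0 is met again writes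
   the output words, terminators included. Each point costs O(1) steps. *)

(** * Inserting points into the two cycles *)

(** With [f] read as a successor table, [p] is linked in right after [w]; the two writes come in the
    order used by [insert_code]. *)
Definition ins (f : nat -> nat) (w p : nat) : nat -> nat :=
  upd (upd f p (f w)) w p.

Lemma eq_in_fpath (f g : nat -> nat) x s :
  {in belast x s, f =1 g} -> fpath f x s = fpath g x s.
Proof.
elim: s x => //= y s IHs x fg; rewrite fg ?mem_head //.
by congr (_ && _); apply: IHs => t ts; rewrite fg // inE ts orbT.
Qed.

Lemma eq_in_fcycle (f g : nat -> nat) c : {in c, f =1 g} -> fcycle f c = fcycle g c.
Proof. by case: c => //= x s fg; apply: eq_in_fpath; rewrite belast_rcons. Qed.

Lemma insE f w p s :
  ins f w p s = if s == w then p else if s == p then f w else f s.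
Proof. by []. Qed.

Lemma fcycle_ins_head f w s p : uniq (w :: s) -> p \notin w :: s ->
  fcycle f (w :: s) -> fcycle (ins f w p) (w :: p :: s).
Proof.
move=> /= /andP[ws us]; rewrite inE negb_or => /andP[pw ps].
have fw' : ins f w p w = p by rewrite insE eqxx.
have fp' : ins f w p p = f w by rewrite insE eqxx (negPf pw).
rewrite fw' eqxx /=.
case: s ws us ps => [|y s] /= ws us ps /andP[/eqP fw pth]; first by rewrite fp' fw eqxx.
rewrite fp' fw eqxx /= -(@eq_in_fpath f) // => t; rewrite belast_rcons insE => tys.
case: eqP => [tw|_]; first by rewrite -tw tys in ws.
by case: eqP => [tp|//]; rewrite -tp tys in ps.
Qed.

(** Rotating by one brings the last element to the head, which reduces this to insertion after the
    head. It serves the cycle being read, which grows at its end. *)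
Lemma fcycle_ins_last f x s p : uniq (x :: s) -> p \notin x :: s ->
  fcycle f (x :: s) -> fcycle (ins f (last x s) p) (x :: rcons s p).
Proof.
rewrite lastI => us ps fc.
rewrite -rcons_cons lastI -rot1_cons rot_cycle -rcons_cons -rot1_cons rot_cycle.
apply: fcycle_ins_head.
- by rewrite -(rot_uniq 1) rot1_cons.
- by rewrite -(mem_rot 1) rot1_cons.
- by rewrite -(rot_cycle 1) rot1_cons.
Qed.

Lemma fcycle_ins f c w p : uniq c -> p \notin c -> w \in c -> fcycle f c ->
  exists2 c', perm_eq c' (p :: c) & fcycle (ins f w p) c'.
Proof.
move=> uc pc wc fc; case: (rot_to wc) => i s E.
exists (w :: p :: s).
  rewrite perm_sym; apply: (@perm_trans _ (p :: w :: s)).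
    by rewrite perm_cons -E perm_sym perm_rot.
  exact/permPl/(perm_catCA [:: p] [:: w] s).
apply: fcycle_ins_head; rewrite -?E ?rot_uniq ?mem_rot //.
by rewrite rot_cycle.
Qed.

Lemma fcycle_mem f (c : seq nat) s : fcycle f c -> s \in c -> f s \in c.
Proof. by move=> fc sc; rewrite (eqP (next_cycle fc sc)) mem_next. Qed.

Lemma fcycle_inj f (c : seq nat) :
  uniq c -> fcycle f c -> {in c &, injective f}.
Proof.
move=> uc fc s t sc tc /eqP.
rewrite (eqP (next_cycle fc sc)) (eqP (next_cycle fc tc)) => /eqP E.
by rewrite -[s](prev_next uc) E prev_next.
Qed.

(** In the new composite, [z] reaches [q] through [p], [p] reaches [A (B z')] through [q], and [z'],
    if distinct from [z], reaches [p] because [B z'] now precedes [p]. Injectivity of [B] ensures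
    that no other point of [c] passes through [B z']. When [z = z'], it is [q] that goes to [p],
    which is why the insertion of [q] is the outer one on the right. *)
Lemma ins_ins_comp A B (c : seq nat) z z' p q s :
  {in c &, injective B} -> {in c, forall t, B t \in c} ->
  z \in c -> z' \in c -> p \notin c -> q \notin c -> p != q ->
  s \in [:: p, q & c] ->
  ins (ins A (B z') q) (B z') p (ins (ins B z q) z p s)
  = ins (ins (A \o B) z' p) z q s.
Proof.
move=> Binj Bc zc z'c pc qc pq.
have ne a b : a \notin c -> b \in c -> (a == b) = false.
  by move=> ac bc; apply/eqP => E; rewrite E bc in ac.
have ne' a b : a \notin c -> b \in c -> (b == a) = false.
  by move=> ac bc; rewrite eq_sym ne.
have qp : (q == p) = false by rewrite eq_sym (negPf pq).
have E a : a \in c -> ((a == p) = false) * ((a == q) = false) *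
                     ((p == a) = false) * ((q == a) = false).
  by move=> ac; rewrite (ne p) // (ne q) // (ne' p) // (ne' q).
have E' := (E z zc, E z' z'c, E _ (Bc z zc), E _ (Bc z' z'c), negPf pq, qp, eqxx).
rewrite !inE !insE /= => /or3P[/eqP->|/eqP->|sc].
- by rewrite !E'.
- by rewrite !E' (inj_in_eq Binj) //; case: (z == z').
- rewrite !(E s sc, E'); case: (eqVneq s z) => [_|sz]; first by rewrite !E'.
  by rewrite !(E _ (Bc s sc)) (inj_in_eq Binj) //; case: (s == z').
Qed.

(** The point [z] still reaches [A (B z)], now through [p], while [p] returns to itself through
    [B z]. *)
Lemma ins_comp A B (c : seq nat) z p s :
  {in c &, injective B} -> {in c, forall t, B t \in c} ->
  z \in c -> p \notin c -> s \in p :: c ->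
  ins A (B z) p (ins B z p s) = upd (A \o B) p p s.
Proof.
move=> Binj Bc zc pc.
have ne b : b \in c -> (p == b) = false.
  by move=> bc; apply/eqP => E; rewrite E bc in pc.
have ne' b : b \in c -> (b == p) = false by move=> bc; rewrite eq_sym ne.
rewrite /upd !inE => /orP[/eqP->|sc].
  by rewrite !insE ne // !eqxx.
rewrite !insE (ne' s) //=; case: (eqVneq s z) => [->|sz].
  by rewrite ne ?Bc // !eqxx.
by rewrite (inj_in_eq Binj) // (negPf sz) ne' ?Bc.
Qed.

Lemma fcycle_ins2 f c w p q : uniq c -> p \notin c -> q \notin c -> p != q ->
  w \in c -> fcycle f c ->
  exists2 c', perm_eq c' [:: p, q & c] & fcycle (ins (ins f w q) w p) c'.
Proof.
move=> uc pc qc pq wc fc; have [c1 P1 F1] := fcycle_ins uc qc wc fc.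
case: (@fcycle_ins (ins f w q) c1 w p) => //.
- by rewrite (perm_uniq P1) /= qc.
- by rewrite (perm_mem P1) inE negb_or pq.
- by rewrite (perm_mem P1) inE wc orbT.
by move=> c2 P2 F2; exists c2 => //; rewrite (perm_trans P2) // perm_cons.
Qed.

(** * Pairs of cycles on a common set of points *)

(** Only the values on [U] matter, and the order of [U] is irrelevant. The member 0 is the dummy
    point at which both cycles are cut open in the end. *)
Definition factor (U : seq nat) (A B : nat -> nat) :=
  [/\ uniq U, 0 \in U
    & exists ca cb, [/\ fcycle A ca, fcycle B cb, perm_eq ca U & perm_eq cb U]].

Lemma factor_mem U A B s : factor U A B -> s \in U -> B s \in U.
Proof.
by case=> _ _ [ca [cb [_ fB _ P]]]; rewrite -!(perm_mem P); apply: fcycle_mem.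
Qed.

Lemma factor_inj U A B : factor U A B -> {in U &, injective B}.
Proof.
case=> uU _ [ca [cb [_ fB _ P]]] s t; rewrite -!(perm_mem P).
by apply: fcycle_inj; rewrite // (perm_uniq P).
Qed.

Lemma factor_ins U A B z x : factor U A B -> z \in U -> x \notin U ->
  factor (x :: U) (ins A (B z) x) (ins B z x) /\
  {in x :: U, ins A (B z) x \o ins B z x =1 upd (A \o B) x x}.
Proof.
move=> fU zU xU; have Bz := factor_mem fU zU; split; last first.
  move=> s; apply: (@ins_comp A B U) => //; first exact: (factor_inj fU).
  by move=> t; apply: (factor_mem fU).
case: fU => uU U0 [ca [cb [fA fB Pa Pb]]].
split; rewrite /= ?xU ?uU ?inE ?U0 ?orbT //.
have [||| ca' Pa' fA'] := fcycle_ins _ _ _ fA (w := B z) (p := x);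
  rewrite ?(perm_uniq Pa) ?(perm_mem Pa) //.
have [||| cb' Pb' fB'] := fcycle_ins _ _ _ fB (w := z) (p := x);
  rewrite ?(perm_uniq Pb) ?(perm_mem Pb) //.
exists ca', cb'; split=> //.
  by rewrite (perm_trans Pa') // perm_cons.
by rewrite (perm_trans Pb') // perm_cons.
Qed.

Lemma factor_ins2 U A B z z' p q : factor U A B ->
  z \in U -> z' \in U -> p \notin U -> q \notin U -> p != q ->
  let A' := ins (ins A (B z') q) (B z') p in
  let B' := ins (ins B z q) z p in
  factor [:: p, q & U] A' B' /\
  {in [:: p, q & U], A' \o B' =1 ins (ins (A \o B) z' p) z q}.
Proof.
move=> fU zU z'U pU qU pq A' B'; have Bz' := factor_mem fU z'U; split; last first.
  move=> s; apply: (@ins_ins_comp A B U) => //; first exact: (factor_inj fU).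
  by move=> t; apply: (factor_mem fU).
case: fU => uU U0 [ca [cb [fA fB Pa Pb]]].
split; rewrite /= ?qU ?uU ?inE ?U0 ?negb_or ?pU ?pq ?orbT //.
have [||||| ca' Pa' fA'] := fcycle_ins2 _ _ _ _ _ fA (w := B z') (p := p) (q := q);
  rewrite ?(perm_uniq Pa) ?(perm_mem Pa) //.
have [||||| cb' Pb' fB'] := fcycle_ins2 _ _ _ _ _ fB (w := z) (p := p) (q := q);
  rewrite ?(perm_uniq Pb) ?(perm_mem Pb) //.
exists ca', cb'; split=> //.
  by rewrite (perm_trans Pa') // !perm_cons.
by rewrite (perm_trans Pb') // !perm_cons.
Qed.

Lemma factor_perm U V A B : perm_eq U V -> factor U A B -> factor V A B.
Proof.
move=> P [uU U0 [ca [cb [fA fB Pa Pb]]]].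
split; rewrite -?(perm_uniq P) -?(perm_mem P) //; exists ca, cb.
by split=> //; rewrite perm_sym (permPl (_ : perm_eq V U)) // 1?perm_sym.
Qed.

(* [p] is the waiting point, to be inserted after [pz]; 0 stands for none. *)
Definition pending_factor (U : seq nat) (S A B : nat -> nat) (pz p : nat) :=
  if p == 0 then factor U A B /\ {in U, S =1 A \o B}
  else uniq U /\ exists V, [/\ perm_eq U (p :: V), factor V A B, pz \in V
                       & {in U, S =1 ins (A \o B) pz p}].

(** Even while a point waits, 0 is among the points already inserted, so [x] can be made a fixed
    point at once. This commutes with the delayed insertion of [p], as [x] differs from both [p] and
    [pz]. *)
Lemma pending_factor_start U S A B pz p x : pending_factor U S A B pz p -> x \notin U ->
  pending_factor (x :: U) (upd S x x) (ins A (B 0) x) (ins B 0 x) pz p.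
Proof.
rewrite /pending_factor; case: eqP => [_ [fU SE] xU|/eqP p0].
  have U0 : 0 \in U by case: fU.
  have [fU' AB] := factor_ins fU U0 xU; split=> // s sU; rewrite AB // /upd.
  by case: eqP sU => // sx; rewrite inE => /orP[/eqP//|/SE].
case=> uU [V [P fV pzV SE]] xU.
have := xU; rewrite (perm_mem P) inE negb_or => /andP[xp xV].
have V0 : 0 \in V by case: fV.
have [fV' AB] := factor_ins fV V0 xV; split; first by rewrite /= xU.
exists (x :: V); split=> //.
- rewrite (perm_trans (_ : perm_eq _ [:: x, p & V])) ?perm_cons //.
  exact/permPl/(perm_catCA [:: x] [:: p] V).
- by rewrite inE pzV orbT.
have ne : pz == x = false by apply/eqP => E; rewrite -E pzV in xV.
move=> s sU; rewrite insE (AB pz) ?inE ?pzV ?orbT // /upd ne.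
case: (eqVneq s x) sU => [->|sx]; rewrite inE.
  by rewrite (negPf xp) eq_sym ne AB ?mem_head // /upd eqxx.
rewrite (negPf sx) orFb => sU; rewrite SE // insE.
case: ifP => // _; case: ifP => // sp; rewrite AB /upd ?(negPf sx) //.
by move: sU; rewrite (perm_mem P) !inE sp (negPf sx).
Qed.

Lemma pending_factor_pend U S A B pz z q :
  pending_factor U S A B pz 0 -> q \notin U -> z \in U ->
  pending_factor (q :: U) (ins S z q) A B z q.
Proof.
rewrite /pending_factor /= => -[fU SE] qU zU; have [uU U0 _] := fU.
(* The new point cannot be mistaken for the code 0 of an absent waiting point, because 0 is in
   [U]. *)
case: eqP => [q0|_]; first by rewrite q0 U0 in qU.
split; first by rewrite /= qU.
exists U; split=> // s; rewrite !insE inE => sU.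
case: ifP => // _; case: ifP sU => /= _; first by rewrite SE.
exact: SE.
Qed.

(** As [z] is not the waiting point, it lies in [V], and one double insertion with [z' = pz] carries
    out both the delayed insertion of [p] and that of [q]. *)
Lemma pending_factor_op U S A B pz p z q :
  p != 0 -> pending_factor U S A B pz p -> q \notin U ->
  z \in U -> z != p ->
  pending_factor (q :: U) (ins S z q) (ins (ins A (B pz) q) (B pz) p)
                (ins (ins B z q) z p) pz 0.
Proof.
rewrite /pending_factor => /negPf -> [uU [V [P fV pzV SE]]] qU zU zp /=.
have := qU; rewrite (perm_mem P) inE negb_or eq_sym => /andP[pq qV].
have := uU; rewrite (perm_uniq P) => /andP[pV _].
have zV : z \in V by move: zU; rewrite (perm_mem P) inE (negPf zp).
have [fV' AB] := factor_ins2 fV zV pzV pV qV pq.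
have P' : perm_eq [:: p, q & V] (q :: U).
  rewrite perm_sym (perm_trans (_ : perm_eq _ [:: q, p & V])) ?perm_cons //.
  exact/permPl/(perm_catCA [:: q] [:: p] V).
split; first exact: factor_perm fV'.
move=> s sU; rewrite [RHS]AB ?(perm_mem P') //.
rewrite [LHS]insE [RHS]insE -SE //; case: eqP => // _.
by case: eqP sU => // /eqP/negPf sq; rewrite inE sq => /SE.
Qed.

(** Here [q] has to follow the waiting point [p], which is not yet in the two cycles. Inserting
    first [q] and then [p] after [pz] in the composite gives [pz], [p], [q] in this order; hence the
    double insertion is used with [z = z' = pz] and the roles of [p] and [q] exchanged. *)
Lemma pending_factor_op' U S A B pz p q :
  p != 0 -> pending_factor U S A B pz p -> q \notin U ->
  pending_factor (q :: U) (ins S p q) (ins (ins A (B pz) p) (B pz) q)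
                (ins (ins B pz p) pz q) pz 0.
Proof.
rewrite /pending_factor => /negPf -> [uU [V [P fV pzV SE]]] qU /=.
have := qU; rewrite (perm_mem P) inE negb_or => /andP[qp qV].
have := uU; rewrite (perm_uniq P) => /andP[pV _].
have [fV' AB] := factor_ins2 fV pzV pzV qV pV qp.
have P' : perm_eq [:: q, p & V] (q :: U) by rewrite perm_cons perm_sym.
split; first exact: factor_perm fV'.
move=> s sU; rewrite [RHS]AB ?(perm_mem P') //.
have pU : p \in U by rewrite (perm_mem P) mem_head.
have ne t : t \notin V -> (pz == t = false) * (t == pz = false).
  by move=> tV; split; apply/eqP => E; [rewrite -E pzV in tV|rewrite E pzV in tV].
rewrite [LHS]insE (SE p) // !insE !(ne p) // !(ne q) // !eqxx /=.
case: (eqVneq s p) => [->|sp]; first by rewrite (ne p).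
case: (eqVneq s q) => [->|sq]; first by rewrite (ne q).
move: sU; rewrite inE (negPf sq) orFb => /SE ->.
by rewrite insE (negPf sp); case: (s == pz).
Qed.

(** * Parity and cycle notation *)

(** The sign is defined through the number of orbits, and the cycles of the notation, taken as sets,
    list each orbit once. *)
Lemma size_cycle_notation_odd n (cs : seq (seq 'I_n)) (s : {perm 'I_n}) :
  cycle_notation cs s -> odd (n + size cs) = s :> bool.
Proof.
case=> P nilcs E; rewrite /odd_perm card_ord oddD; congr (_ (+) odd _).
have uf : uniq (flatten cs) by rewrite (perm_uniq P) enum_uniq.
have porbitE c x : c \in cs -> x \in c -> porbit s x = [set y in c].
  move=> ccs xc; have fc : fcycle s c.
    have /eq_in_cycle <- // : {in c &, forall a b, (next c a == b) = frel s a b}.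
      by move=> a b ac _ /=; rewrite (E c).
    have uc : uniq c.
      elim: (cs) uf ccs => //= d ds IH; rewrite cat_uniq => /and3P[ud _ uds].
      by rewrite inE => /orP[/eqP->|/(IH uds)].
    exact: cycle_next.
  apply/setP => y; rewrite inE -(fconnect_cycle fc xc).
  apply/porbitP/idP => [[i ->]|/iter_findex <-].
    by rewrite permX fconnect_iter.
  by exists (findex s x y); rewrite permX.
(* Distinct entries give distinct sets, since the cycles are nonempty and disjoint. *)
have us : uniq [seq [set y in c] | c <- cs].
  elim: (cs) uf nilcs => //= c ds IH; rewrite cat_uniq inE => /and3P[uc dis uds].
  rewrite negb_or => /andP[c0 ds0]; rewrite (IH uds ds0) andbT.
  apply/mapP => -[d dds /setP cd]; case: c c0 dis cd {uc} => // a c _ /hasPn dis.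
  move=> /(_ a); rewrite !inE eqxx /= => /esym ad.
  have /dis : a \in flatten ds by apply/flattenP; exists d.
  by rewrite mem_head.
rewrite -(size_map (fun c => [set y in c])) -(card_uniqP us).
apply: eq_card => X; apply/mapP/imsetP => [[c ccs ->]|[x _ ->]].
  case: c ccs => [|x c] ccs; first by rewrite ccs in nilcs.
  by exists x => //; rewrite (porbitE (x :: c)) ?mem_head.
have : x \in flatten cs by rewrite (perm_mem P) mem_enum.
by case/flattenP => c ccs xc; exists c; rewrite // (porbitE c).
Qed.

(** The orbits of [s] are listed from their canonical roots. This serves the purely existential half
    of the theorem, where no notation is given. *)
Lemma cycle_notation_exists n (s : {perm 'I_n}) : exists cs, cycle_notation cs s.
Proof.
have sinj : injective s by exact: perm_inj.
have symc := fconnect_sym sinj.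
exists [seq fingraph.orbit s x | x <- enum (froots s)]; split.
- apply: uniq_perm; rewrite ?enum_uniq //.
    have : {subset enum (froots s) <= froots s} by move=> x; rewrite mem_enum.
    (* Orbits of different roots are disjoint: a common point would force the roots to coincide. *)
    elim: (enum _) (enum_uniq (froots s)) => //= x xs IH /andP[xxs uxs] sub.
    rewrite cat_uniq orbit_uniq IH // ?andbT; last first.
      by move=> y yxs; apply: sub; rewrite inE yxs orbT.
    apply/hasPn => y /flattenP[_ /mapP[z zxs ->]].
    rewrite -!fconnect_orbit => zy; apply/negP => xy.
    have xz : fconnect s x z by apply: connect_trans xy _; rewrite symc.
    have /eqP rx := sub _ (mem_head x xs).
    have /eqP rz : z \in froots s by apply: sub; rewrite inE zxs orbT.
    have : froot s x == froot s z by rewrite root_connect.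
    by rewrite rx rz => /eqP xz'; rewrite xz' zxs in xxs.
  move=> x; rewrite mem_enum; apply/flattenP.
  exists (fingraph.orbit s (froot s x)).
    by apply: map_f; rewrite mem_enum; exact: roots_root.
  by rewrite -fconnect_orbit symc connect_root.
- apply/mapP => -[x _ nilx].
  by have := in_orbit s x; rewrite -nilx.
move=> c x /mapP[r _ ->] xr; apply/eqP.
exact: (next_cycle (cycle_orbit sinj r) xr).
Qed.

(** * The invariant of the reading loop *)

(* The words of [done] have been read completely, and [c] is the part already
   read of the current cycle. *)
Definition loop_inv (done : seq (seq nat)) (c : seq nat) (A B : nat -> nat) z pz p :=
  exists U S, [/\ pending_factor U S A B pz p /\ perm_eq U (0 :: flatten done ++ c),
    S 0 = 0, {in done, forall d, fcycle S d}, fcycle S c /\ z = last 0 c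
    & odd (size U + size done + (c != [::])) = (p == 0)].

(** Since [size U] also counts the dummy 0, the parity clause says that no point waits exactly when
    the number of points read plus the number of cycles begun is even. While [p] is 0, [pz] is
    arbitrary. *)
Lemma loop_inv_init pz : loop_inv [::] [::] (fun=> 0) (fun=> 0) 0 pz 0.
Proof.
exists [:: 0], (fun=> 0); split=> //; split=> //=; split=> //; split=> //.
by exists [:: 0], [:: 0].
Qed.

(** At every stage [S] already closes the current cycle, so its end changes neither [A] nor [B]; in
    the parity clause one cycle moves from [c] to [done]. *)
Lemma loop_inv_close done c A B z pz p : c != [::] ->
  loop_inv done c A B z pz p -> loop_inv (rcons done c) [::] A B 0 pz p.
Proof.
move=> c0 [U [S [[pending_factor PU] S0 dS [cS _] par]]]; exists U, S; split=> //.
- by split; rewrite // flatten_rcons cats0.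
- by move=> d; rewrite mem_rcons inE => /orP[/eqP->|/dS].
by rewrite -par size_rcons c0 addn0 addn1 addnS.
Qed.

Lemma pending_factor_uniq U S A B pz p : pending_factor U S A B pz p -> uniq U.
Proof. by rewrite /pending_factor; case: ifP => _ [] // []. Qed.

Lemma fcycle_ins_notin f z q d : z \notin d -> q \notin d ->
  fcycle (ins f z q) d = fcycle f d.
Proof.
move=> zd qd; apply: eq_in_fcycle => x xd; rewrite insE.
case: (eqVneq x z) => [E|_]; first by rewrite -E xd in zd.
by case: (eqVneq x q) => // E; rewrite -E xd in qd.
Qed.

(** One more point and one more cycle leave the parity unchanged, in agreement with the unchanged
    [p]. *)
Lemma loop_inv_start done A B z pz p x : x \notin 0 :: flatten done ->
  loop_inv done [::] A B z pz p ->
  loop_inv done [:: x] (ins A (B 0) x) (ins B 0 x) x pz p.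
Proof.
move=> xd [U [S [[pending_factor PU] S0 dS [cS _] par]]]; exists (x :: U), (upd S x x).
have xU : x \notin U by rewrite (perm_mem PU) cats0.
split=> //=; last by rewrite -par eqxx /= addn0 addn1 /= negbK.
- split; first exact: pending_factor_start.
  rewrite perm_sym (perm_trans (_ : perm_eq _ (x :: 0 :: flatten done))) //.
    by rewrite -cat_cons perm_catC.
  by rewrite perm_cons perm_sym -[flatten done]cats0.
- by rewrite /upd; case: eqP xd => // <-; rewrite mem_head.
- move=> d dd; rewrite (@eq_in_fcycle _ S) ?dS // => y yd; rewrite /upd.
  case: eqP => // yx; case/negP: xd; rewrite -yx inE; apply/orP; right.
  by apply/flattenP; exists d.
by split; rewrite //= /upd !eqxx.
Qed.

(** The common part of the three ways to extend the current cycle: [S] receives [x] after the last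
    point [z], and the parity flips, so a waiting point appears or disappears. *)
Lemma loop_inv_next done c A B z pz p A' B' pz' p' x : c != [::] ->
  x \notin 0 :: flatten done ++ c -> (p' == 0) = (p != 0) ->
  loop_inv done c A B z pz p ->
  (forall U S, pending_factor U S A B pz p -> x \notin U -> z \in U ->
     pending_factor (x :: U) (ins S z x) A' B' pz' p') ->
  loop_inv done (rcons c x) A' B' x pz' p'.
Proof.
move=> c0 xd pp' [U [S [[cor PU] S0 dS [cS zE] par]]] pending_factor'.
exists (x :: U), (ins S z x).
have xU : x \notin U by rewrite (perm_mem PU).
have zc : z \in c by rewrite zE; case: (c) c0 => //= a l _; apply: mem_last.
have zU : z \in U by rewrite (perm_mem PU) inE mem_cat zc !orbT.
have := pending_factor_uniq cor; rewrite (perm_uniq PU) /= mem_cat negb_or cat_uniq.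
case/andP=> /andP[d0 c00] /and3P[_ /hasPn dis uc].
have xc : x \notin c by apply: contra xd => xc; rewrite inE mem_cat xc !orbT.
split.
- split; first exact: pending_factor'.
  rewrite perm_sym (perm_trans (_ : perm_eq _ (x :: 0 :: flatten done ++ c))) //.
    by rewrite -rcons_cat -rcons_cons perm_rcons.
  by rewrite perm_cons perm_sym.
- rewrite insE S0; case: eqP zc => [<-|_ _]; first by rewrite (negPf c00).
  by case: eqP xd => // <-; rewrite mem_head.
- move=> d dd; rewrite fcycle_ins_notin ?dS //.
    by apply/negP => zd; case/negP: (dis z zc); apply/flattenP; exists d.
  apply: contra xd => xd; rewrite inE mem_cat; apply/orP; right.
  by apply/orP; left; apply/flattenP; exists d.
- split; last by rewrite last_rcons.
  rewrite zE; case: (c) c0 uc xc cS => //= a l _ uc xc cS.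
  exact: fcycle_ins_last.
by rewrite pp' -par c0 -size_eq0 size_rcons.
Qed.

Lemma loop_inv_pend done c A B z pz x : c != [::] -> x \notin 0 :: flatten done ++ c ->
  loop_inv done c A B z pz 0 -> loop_inv done (rcons c x) A B x z x.
Proof.
move=> c0 xd Hi; apply: (loop_inv_next c0 xd _ Hi) => [|U S cor xU zU].
  by case: eqP xd => // ->; rewrite mem_head.
exact: pending_factor_pend cor xU zU.
Qed.

Lemma loop_inv_op done c A B z pz p x : c != [::] -> x \notin 0 :: flatten done ++ c ->
  p != 0 -> z != p -> loop_inv done c A B z pz p ->
  loop_inv done (rcons c x) (ins (ins A (B pz) x) (B pz) p)
      (ins (ins B z x) z p) x pz 0.
Proof.
move=> c0 xd p0 zp Hi; apply: (loop_inv_next c0 xd _ Hi) => [|U S cor xU zU].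
  by rewrite p0.
exact: pending_factor_op.
Qed.

Lemma loop_inv_op' done c A B pz p x : c != [::] -> x \notin 0 :: flatten done ++ c ->
  p != 0 -> loop_inv done c A B p pz p ->
  loop_inv done (rcons c x) (ins (ins A (B pz) p) (B pz) x)
      (ins (ins B pz p) pz x) x pz 0.
Proof.
move=> c0 xd p0 Hi; apply: (loop_inv_next c0 xd _ Hi) => [|U S cor xU zU].
  by rewrite p0.
exact: pending_factor_op'.
Qed.

(** These values serve as table indices, so the bounds keep every access inside the tables. Nothing
    is known about [pz] when no point waits. *)
Lemma loop_inv_bound n done c A B z pz p : loop_inv done c A B z pz p ->
  {in flatten done ++ c, forall x, x <= n} ->
  [/\ z <= n, p <= n, B 0 <= n & p != 0 -> pz <= n /\ B pz <= n].
Proof.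
case=> U [S [[cor PU] S0 dS [cS ->] par]] bnd.
have bU x : x \in U -> x <= n.
  by rewrite (perm_mem PU) inE => /orP[/eqP->|/bnd].
have zU : last 0 c <= n.
  apply: bU; rewrite (perm_mem PU); case: (c) => //= a l.
  by rewrite inE mem_cat mem_last !orbT.
move: cor; rewrite /pending_factor; case: eqP => [-> [fU _]|_ [_ [V [PV fV pzV _]]]].
  by split=> //; apply: bU; apply: (factor_mem fU); case: fU.
have VU x : x \in V -> x <= n.
  by move=> xV; apply: bU; rewrite (perm_mem PV) inE xV orbT.
split=> //; first by apply: bU; rewrite (perm_mem PV) mem_head.
  by apply: VU; apply: (factor_mem fV); case: fV.
by move=> _; split; apply: VU => //; apply: (factor_mem fV).
Qed.

(** * Deleting the dummy point *)

(** The shift by one, the same as in [word], frees 0 for the dummy point and the terminator. *)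
Definition point n (x : 'I_n) : nat := (val x).+1.

Lemma point_inj n : injective (@point n).
Proof. by move=> x y [/val_inj]. Qed.

Lemma map_point_enum n : [seq point x | x <- enum 'I_n] = iota 1 n.
Proof.
by rewrite -[1]addn0 iotaDl -val_enum_ord -map_comp.
Qed.

Lemma seq_point n (l : seq nat) : perm_eq l (iota 1 n) ->
  exists2 sa : seq 'I_n, perm_eq sa (enum 'I_n) & l = [seq point x | x <- sa].
Proof.
move=> P; have [sa E] : exists sa : seq 'I_n, l = [seq point x | x <- sa].
  have : {subset l <= iota 1 n} by move=> x; rewrite (perm_mem P).
  elim: (l) => [|x s IH] sub; first by exists [::].
  have [|sa ->] := IH; first by move=> y ys; apply: sub; rewrite inE ys orbT.
  have := sub x (mem_head _ _); rewrite mem_iota; case: x {sub} => // x xn.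
  by exists (Ordinal (xn : x < n) :: sa).
exists sa => //; apply: (perm_map_inj (@point_inj n)).
by rewrite -E map_point_enum.
Qed.

Lemma next_drop0 f la s : uniq (0 :: la) -> fcycle f (0 :: la) -> s \in la ->
  next la s = if f s == 0 then f 0 else f s.
Proof.
case: la => // x l /andP[l0 _] /andP[/eqP fx pl] sxl.
set g := fun t => if f t == 0 then f 0 else f t.
suff fg : fcycle g (x :: l) by rewrite -(eqP (next_cycle fg sxl)).
suff : fpath g x (rcons l x) by [].
move: (pl : fpath f x (rcons l 0)); rewrite !rcons_path => /andP[{}pl /eqP/= f0].
rewrite inE negb_or in l0; case/andP: l0 => _ l0.
(* Before the end of the path [f] never takes the value 0, so [g] agrees with it; at the last point
   [f] gives 0 and [g] jumps on to [f 0 = x]. *)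
apply/andP; split.
  move: l0; elim: (l) (x) pl => //= y l' IH t /andP[/eqP ft pl']; rewrite inE negb_or.
  by rewrite eq_sym /g ft => /andP[/negPf-> l'0]; rewrite eqxx IH.
by rewrite /g /= f0 eqxx fx.
Qed.

(** Each cycle is rotated so as to start at 0; what follows 0 is then an enumeration of all the
    points. *)
Lemma factor_final n U A B : factor U A B -> perm_eq U (0 :: iota 1 n) ->
  exists sa sb : seq 'I_n,
    [/\ perm_eq sa (enum 'I_n), perm_eq sb (enum 'I_n),
        fcycle A (0 :: [seq point x | x <- sa])
      & fcycle B (0 :: [seq point x | x <- sb])].
Proof.
move=> [_ U0 [ca [cb [fA fB Pa Pb]]]] PU.
have aux f c : fcycle f c -> perm_eq c U -> exists2 sa : seq 'I_n,
    perm_eq sa (enum 'I_n) & fcycle f (0 :: [seq point x | x <- sa]).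
  move=> fc Pc; have c0 : 0 \in c by rewrite (perm_mem Pc).
  have [i l E] := rot_to c0.
  have /seq_point[sa Psa Esa] : perm_eq l (iota 1 n).
    by rewrite -(perm_cons 0) -E perm_rot (perm_trans Pc).
  by exists sa => //; rewrite -Esa -E rot_cycle.
have [sa ? ?] := aux _ _ fA Pa; have [sb ? ?] := aux _ _ fB Pb.
by exists sa, sb.
Qed.

(** With the whole input read, points and cycles number [n + size cs], which is even for an even
    permutation. By the parity clause no point waits, so [S] equals [A \o B], and it remains to
    delete 0 from both cycles. *)
Lemma loop_inv_final n (s : {perm 'I_n}) (cs : seq (seq 'I_n)) A B z pz p :
  s \in ('Alt_('I_n))%g -> cycle_notation cs s ->
  loop_inv [seq [seq point x | x <- c] | c <- cs] [::] A B z pz p ->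
  exists sa sb : seq 'I_n,
    [/\ perm_eq sa (enum 'I_n), perm_eq sb (enum 'I_n),
        fcycle A (0 :: [seq point x | x <- sa]),
        fcycle B (0 :: [seq point x | x <- sb])
      & forall x, s x = next sa (next sb x)].
Proof.
rewrite Alt_even => s_even cn [U [S [[cor PU] S0 dS _ par]]].
have [P nilcs nextcs] := cn; have sz := size_cycle_notation_odd cn.
have {}PU : perm_eq U (0 :: iota 1 n).
  rewrite (perm_trans PU) // perm_cons cats0 -map_flatten -map_point_enum.
  exact: perm_map.
have p0 : p == 0.
  rewrite -par (perm_size PU) /= size_iota size_map addn0 sz.
  exact: s_even.
move: cor; rewrite /pending_factor p0 => -[fU SE].
have [sa [sb [Pa Pb fA fB]]] := factor_final fU PU.
exists sa, sb; split=> // x.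
have U_pt (y : 'I_n) : point y \in U.
  by rewrite (perm_mem PU) inE mem_iota add1n ltnS /point /= (ltn_ord y).
have u0 (t : seq 'I_n) : perm_eq t (enum 'I_n) -> uniq (0 :: [seq point x | x <- t]).
  move=> Pt; rewrite /= (map_inj_uniq (@point_inj n)) (perm_uniq Pt) enum_uniq andbT.
  by apply/mapP => -[].
have nextE (t : seq 'I_n) f y : perm_eq t (enum 'I_n) ->
    fcycle f (0 :: [seq point x | x <- t]) ->
    point (next t y) = if f (point y) == 0 then f 0 else f (point y).
  move=> Pt ft; rewrite -(next_drop0 (u0 _ Pt) ft); last first.
    by apply: map_f; rewrite (perm_mem Pt) mem_enum.
  by rewrite next_map ?(perm_uniq Pt) ?enum_uniq //; apply: point_inj.
apply: point_inj; rewrite (nextE sa A) // (nextE sb B) //.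
have AB y : y \in U -> A (B y) = S y by move/SE.
have Sx : S (point x) = point (s x).
  have : x \in flatten cs by rewrite (perm_mem P) mem_enum.
  case/flattenP => c ccs xc; rewrite (nextcs c) //.
  have uc : uniq c.
    have : uniq (flatten cs) by rewrite (perm_uniq P) enum_uniq.
    elim: (cs) ccs => //= d ds IH; rewrite cat_uniq inE.
    by case/orP=> [/eqP->|/IH{}IH] /and3P[].
  rewrite -(next_map (@point_inj n)) //; apply/eqP.
  by apply: (next_cycle (dS _ _)); apply: map_f.
have U0 : 0 \in U by case: fU.
(* If [B] sends [x] to 0, the shortened cycle sends it to [B 0]. As [A (B 0) = S 0 = 0], the dummy
   is skipped again, which gives [A 0 = A (B x) = S x]. Otherwise [A (B x) = S x] is nonzero and
   nothing is skipped. *)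
case: (eqVneq (B (point x)) 0) => [B0|_].
  by rewrite AB // S0 eqxx -B0 AB.
by rewrite AB // Sx.
Qed.

Definition perm_of_cycle n (sa : seq 'I_n) (ua : uniq sa) : {perm 'I_n} :=
  perm (can_inj (prev_next ua)).

Lemma perm_of_cycle_notation n (sa : seq 'I_n) (ua : uniq sa) :
  0 < n -> perm_eq sa (enum 'I_n) -> 
  is_kcycle n (perm_of_cycle ua) /\ cycle_notation [:: sa] (perm_of_cycle ua).
Proof.
move=> n0 P; have sz : size sa = n by rewrite (perm_size P) size_enum_ord.
split; first by exists sa; split=> // x; rewrite permE.
split=> /=; first by rewrite cats0.
- by rewrite inE eq_sym -size_eq0 sz -lt0n.
- by move=> c x; rewrite inE => /eqP-> _; rewrite permE.
Qed.

(** * Execution of the program *)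

(** A variant of [halts_within] with a postcondition and without halting, so that runs of code
    fragments can be chained and their time bounds added. *)
Definition reaches (P : program) (N T : nat) (c : config) (Q : config -> Prop) :=
  exists t, [/\ t <= T, forall i, i <= t -> bounded N (iter i (step P) c)
              & Q (iter t (step P) c)].

Lemma reaches_now P N T c (Q : config -> Prop) :
  bounded N c -> Q c -> reaches P N T c Q.
Proof. by move=> bc Qc; exists 0; split=> // -[]. Qed.

Lemma reaches_step P N T c Q :
  bounded N c -> reaches P N T (step P c) Q -> reaches P N T.+1 c Q.
Proof.
move=> bc [t [tT bt Qt]]; exists t.+1; rewrite iterSr; split=> //.
by move=> [|i] //; rewrite iterSr; apply: bt.
Qed.

Lemma reaches_trans P N T1 T2 T c (Q1 Q2 : config -> Prop) :
  T1 + T2 <= T -> reaches P N T1 c Q1 ->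
  (forall c', Q1 c' -> reaches P N T2 c' Q2) -> reaches P N T c Q2.
Proof.
move=> T12 [t1 [tT1 b1 Q1c]] /(_ _ Q1c)[t2 [tT2 b2 Q2c]].
exists (t2 + t1); rewrite iterD; split=> //; first by lia.
move=> i ile; have [/b1//|lt1] := leqP i t1.
by rewrite -(subnK (ltnW lt1)) iterD; apply: b2; lia.
Qed.

Lemma reaches_leq P N T1 T2 c Q :
  T1 <= T2 -> reaches P N T1 c Q -> reaches P N T2 c Q.
Proof. by move=> T12 [t [tT b Qt]]; exists t; split=> //; apply: leq_trans T12. Qed.

Lemma reaches_imp P N T c (Q1 Q2 : config -> Prop) :
  (forall c', Q1 c' -> Q2 c') -> reaches P N T c Q1 -> reaches P N T c Q2.
Proof. by move=> Q12 [t [tT b Qt]]; exists t; split=> //; apply: Q12. Qed.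

Lemma bounded_reg N k k' R M r v :
  bounded N (Config k R M) -> v <= N -> bounded N (Config k' (upd R r v) M).
Proof. by move=> [bR bM] vN; split=> //= i; rewrite /upd; case: eqP. Qed.

Lemma bounded_cell N k k' R M a v :
  bounded N (Config k R M) -> v <= N -> bounded N (Config k' R (upd M a v)).
Proof. by move=> [bR bM] vN; split=> //= i; rewrite /upd; case: eqP. Qed.

Lemma upd_neq f i v j : j != i -> upd f i v j = f j.
Proof. by rewrite /upd => /negPf ->. Qed.

Section Exec.

Variables (P : program) (N T k : nat) (R M : nat -> nat) (Q : config -> Prop).
Hypothesis bc : bounded N (Config k R M).

(** The rules from here on execute one instruction each and pass boundedness on. Only constants and
    sums need a new bound on [v]; reads and writes copy values already present. *)
Lemma exec_const r v : nth Halt P k = Const r v -> v <= N ->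
  (bounded N (Config k.+1 (upd R r v) M) ->
     reaches P N T (Config k.+1 (upd R r v) M) Q) ->
  reaches P N T.+1 (Config k R M) Q.
Proof.
move=> E vN H; apply: reaches_step => //; rewrite /step /fetch E.
exact/H/(bounded_reg _ _ bc).
Qed.

Lemma exec_add r a b v : nth Halt P k = Arith Add r a b -> R a + R b = v ->
  v <= N ->
  (bounded N (Config k.+1 (upd R r v) M) ->
     reaches P N T (Config k.+1 (upd R r v) M) Q) ->
  reaches P N T.+1 (Config k R M) Q.
Proof.
move=> E Ev vN H; apply: reaches_step => //; rewrite /step /fetch E /= Ev.
exact/H/(bounded_reg _ _ bc).
Qed.

Lemma exec_read r a v : nth Halt P k = Read r a -> M (R a) = v ->
  (bounded N (Config k.+1 (upd R r v) M) ->
     reaches P N T (Config k.+1 (upd R r v) M) Q) ->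
  reaches P N T.+1 (Config k R M) Q.
Proof.
move=> E Ev H; apply: reaches_step => //; rewrite /step /fetch E /= Ev.
by apply/H/(bounded_reg _ _ bc); rewrite -Ev; apply: bc.2.
Qed.

Lemma exec_write r a u v : nth Halt P k = Write a r -> R a = u -> R r = v ->
  (bounded N (Config k.+1 R (upd M u v)) ->
     reaches P N T (Config k.+1 R (upd M u v)) Q) ->
  reaches P N T.+1 (Config k R M) Q.
Proof.
move=> E Eu Ev H; apply: reaches_step => //; rewrite /step /fetch E /= Eu Ev.
by apply/H/(bounded_cell _ _ bc); rewrite -Ev; apply: bc.1.
Qed.

Lemma exec_jump_lt a b l k' : nth Halt P k = JumpLt a b l ->
  k' = (if R a < R b then l else k.+1) ->
  (bounded N (Config k' R M) -> reaches P N T (Config k' R M) Q) ->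
  reaches P N T.+1 (Config k R M) Q.
Proof.
by move=> E -> H; apply: reaches_step => //; rewrite /step /fetch E; apply: H.
Qed.

Lemma exec_jump_eq a b l k' : nth Halt P k = JumpEq a b l ->
  k' = (if R a == R b then l else k.+1) ->
  (bounded N (Config k' R M) -> reaches P N T (Config k' R M) Q) ->
  reaches P N T.+1 (Config k R M) Q.
Proof.
by move=> E -> H; apply: reaches_step => //; rewrite /step /fetch E; apply: H.
Qed.

Lemma exec_goto a l : nth Halt P k = JumpEq a a l ->
  (bounded N (Config l R M) -> reaches P N T (Config l R M) Q) ->
  reaches P N T.+1 (Config k R M) Q.
Proof. by move=> E; apply: exec_jump_eq E _; rewrite eqxx. Qed.

End Exec.

(** * The program and its memory layout *)

(** Carries out [ins] on the table whose base address is in register [b], with registers 10 to 12 as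
    scratch. *)
Definition insert_code (b w p : nat) : program :=
  [:: Arith Add 10 b w; Arith Add 11 b p; Read 12 10; Write 11 12; Write 10 p].

(** Follows the table from the point in register 5 and writes out each value met. The test comes
    after the write, so the final 0 is written as well. *)
Definition walk_code (b k : nat) : program :=
  [:: Arith Add 10 b 5; Read 5 10; Write 17 5; Arith Add 17 17 1; JumpLt 9 5 k].

(* Registers: 1 holds 1, 2 and 3 the addresses 4n of A and 6n of B, 4 the next
   input address, 5 the current token, 6 the last point of the current cycle (0
   between cycles), 7 and 8 the pair pz, p, 9 holds 0, 17 the next output
   address. A 0 read between two cycles marks the end of the input, as cycles
   are not empty. The comments give the addresses of jump targets. *)
Definition prog : program :=
  [:: Const 1 1; Arith Add 2 0 0; Arith Add 2 2 2; Arith Add 3 2 0;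
      Arith Add 3 3 0] ++
  (* 5 *)
  [:: Read 5 4; Arith Add 4 4 1; JumpEq 5 9 58; JumpEq 6 9 45; JumpEq 8 9 42;
      Arith Add 16 3 7; Read 16 16; JumpEq 6 8 17] ++
  (* 13 *)
  [:: Arith Add 13 6 9; Arith Add 14 8 9; Arith Add 15 5 9; JumpEq 9 9 20] ++
  (* 17 *)
  [:: Arith Add 13 7 9; Arith Add 14 5 9; Arith Add 15 8 9] ++
  (* 20 *)
  insert_code 2 16 15 ++ insert_code 2 16 14 ++
  insert_code 3 13 15 ++ insert_code 3 13 14 ++
  (* 40 *)
  [:: Arith Add 8 9 9; JumpEq 9 9 56] ++
  (* 42 *)
  [:: Arith Add 7 6 9; Arith Add 8 5 9; JumpEq 9 9 56] ++
  (* 45 *)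
  [:: Read 16 3] ++ insert_code 2 16 5 ++ insert_code 3 9 5 ++
  (* 56 *)
  [:: Arith Add 6 5 9; JumpEq 9 9 5] ++
  (* 58 *)
  [:: JumpEq 6 9 61; Arith Add 6 9 9; JumpEq 9 9 5] ++
  (* 61 *)
  walk_code 2 61 ++ walk_code 3 66 ++ [:: Halt].

(** Tables of [n + 1] cells at 4n and 6n are disjoint and lie above both the input, of length at
    most 2n, and the output, of length 2n + 2, which overwrites it. The cells between the input and
    4n hold the 0 that marks the end of the input. *)
Definition mem_rep n (w : seq nat) A B (M : nat -> nat) :=
  [/\ forall j, j <= n -> M (4 * n + j) = A j,
      forall j, j <= n -> M (6 * n + j) = B j
    & forall j, j < 4 * n -> M j = nth 0 w j].

Lemma exec_insert b w p P N k R M :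
  (forall j, j < 5 -> nth Halt P (j + k) = nth Halt (insert_code b w p) j) ->
  all (fun r => (r < 10) || (12 < r)) [:: b; w; p] ->
  bounded N (Config k R M) -> R b + R w <= N -> R b + R p <= N ->
  reaches P N 5 (Config k R M) (fun c => exists R',
    let M' := upd (upd M (R b + R p) (M (R b + R w))) (R b + R w) (R p) in
    [/\ c = Config (5 + k) R' M', bounded N c &
        forall j, (j < 10) || (12 < j) -> R' j = R j]).
Proof.
move=> code /and4P[hb hw hp _] bc wN pN.
have ne r s : (r < 10) || (12 < r) -> 10 <= s <= 12 -> (r == s) = false.
  by move=> *; apply/eqP; lia.
apply: (exec_add bc (code 0 isT) (erefl _)) => // {}bc.
apply: (exec_add (v := R b + R p) bc (code 1 isT)) => // [|{}bc].
  by rewrite /upd !ne.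
apply: (exec_read (v := M (R b + R w)) bc (code 2 isT)) => // {}bc.
apply: (exec_write (u := R b + R p) (v := M (R b + R w)) bc (code 3 isT)) => // {}bc.
apply: (exec_write (u := R b + R w) (v := R p) bc (code 4 isT)) => // [|{}bc].
  by rewrite /upd !ne.
apply: reaches_now => //; eexists; split; [by []|by []|].
by move=> j jr; rewrite /upd !ne.
Qed.

Lemma exec_insertA n W A B w p P k R M : 0 < n ->
  (forall j, j < 5 -> nth Halt P (j + k) = nth Halt (insert_code 2 w p) j) ->
  (w < 10) || (12 < w) -> (p < 10) || (12 < p) ->
  bounded (8 * n) (Config k R M) -> R w <= n -> R p <= n ->
  R 2 = 4 * n -> mem_rep n W A B M ->
  reaches P (8 * n) 5 (Config k R M) (fun c => exists R' M',
    [/\ c = Config (5 + k) R' M', bounded (8 * n) c,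
        forall j, (j < 10) || (12 < j) -> R' j = R j
      & mem_rep n W (ins A (R w) (R p)) B M']).
Proof.
move=> n0 code hw hp bc wn pn R2 [mA mB mW].
apply: reaches_trans (exec_insert code _ bc _ _) _; rewrite /= ?hw ?hp ?R2 //; try lia.
  exact: (leqnn (5 + 0)).
move=> c [R' [Ec b' fr]]; subst c.
apply: reaches_now => //; eexists; eexists; split=> //.
have hA j v : j <= n -> v <= n -> (4 * n + j == 4 * n + v) = (j == v).
  by move=> *; rewrite eqn_add2l.
split=> j jn.
- by rewrite /upd !hA // insE !mA.
- by rewrite !upd_neq ?mB //; apply/eqP; lia.
- by rewrite !upd_neq ?mW //; apply/eqP; lia.
Qed.

Lemma exec_insertB n W A B w p P k R M : 0 < n ->
  (forall j, j < 5 -> nth Halt P (j + k) = nth Halt (insert_code 3 w p) j) ->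
  (w < 10) || (12 < w) -> (p < 10) || (12 < p) ->
  bounded (8 * n) (Config k R M) -> R w <= n -> R p <= n ->
  R 3 = 6 * n -> mem_rep n W A B M ->
  reaches P (8 * n) 5 (Config k R M) (fun c => exists R' M',
    [/\ c = Config (5 + k) R' M', bounded (8 * n) c,
        forall j, (j < 10) || (12 < j) -> R' j = R j
      & mem_rep n W A (ins B (R w) (R p)) M']).
Proof.
move=> n0 code hw hp bc wn pn R3 [mA mB mW].
apply: reaches_trans (exec_insert code _ bc _ _) _; rewrite /= ?hw ?hp ?R3 //; try lia.
  exact: (leqnn (5 + 0)).
move=> c [R' [Ec b' fr]]; subst c.
apply: reaches_now => //; eexists; eexists; split=> //.
have hB j v : j <= n -> v <= n -> (6 * n + j == 6 * n + v) = (j == v).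
  by move=> *; rewrite eqn_add2l.
split=> j jn.
- by rewrite !upd_neq ?mA //; apply/eqP; lia.
- by rewrite /upd !hB // insE !mB.
- by rewrite !upd_neq ?mW //; apply/eqP; lia.
Qed.

(** Registers 13 to 16 are outside the scratch range, so the operands survive from one insertion to
    the next. *)
Lemma exec_op n W A B R M w z p q : 0 < n ->
  bounded (8 * n) (Config 20 R M) -> mem_rep n W A B M ->
  R 2 = 4 * n -> R 3 = 6 * n -> R 13 = z -> R 14 = p -> R 15 = q -> R 16 = w ->
  z <= n -> p <= n -> q <= n -> w <= n ->
  reaches prog (8 * n) 20 (Config 20 R M) (fun c => exists R' M',
    [/\ c = Config 40 R' M', bounded (8 * n) c,
        forall j, (j < 10) || (12 < j) -> R' j = R j
      & mem_rep n W (ins (ins A w q) w p) (ins (ins B z q) z p) M']).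
Proof.
move=> n0 bc mem R2 R3 R13 R14 R15 R16 zn pn qn wn.
have code b x y k :
    take 5 (drop k prog) = insert_code b x y ->
    forall j, j < 5 -> nth Halt prog (j + k) = nth Halt (insert_code b x y) j.
  by move=> <- j j5; rewrite nth_take // nth_drop addnC.
apply: (@reaches_trans _ _ 5 15) => //.
  by apply: (exec_insertA (w := 16) (p := 15) n0 (code _ _ _ _ _) _ _ bc _ _ R2 mem);
    rewrite ?R16 ?R15.
move=> c [R' [M' [Ec {}bc fr {}mem]]]; subst c.
apply: (@reaches_trans _ _ 5 10) => //.
  by apply: (exec_insertA (w := 16) (p := 14) n0 (code _ _ _ _ _) _ _ bc _ _ _ mem);
    rewrite ?fr ?R16 ?R14.
move=> c [R'' [M'' [Ec {}bc fr' {}mem]]]; subst c.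
apply: (@reaches_trans _ _ 5 5) => //.
  by apply: (exec_insertB (w := 13) (p := 15) n0 (code _ _ _ _ _) _ _ bc _ _ _ mem);
    rewrite ?fr' ?fr ?R13 ?R15.
move=> c [R3' [M3 [Ec {}bc fr3 {}mem]]]; subst c.
apply: (@reaches_trans _ _ 5 0) => //.
  by apply: (exec_insertB (w := 13) (p := 14) n0 (code _ _ _ _ _) _ _ bc _ _ _ mem);
    rewrite ?fr3 ?fr' ?fr ?R13 ?R14.
move=> c [R4' [M4 [Ec {}bc fr4 {}mem]]]; subst c.
apply: reaches_now => //; exists R4', M4; split=> //.
  by move=> j jr; rewrite fr4 // fr3 // fr' // fr.
by move: mem; rewrite !fr3 // !fr' // !fr // R13 R14 R15 R16.
Qed.

(** * Processing one token *)

Definition reg_rep n i z pz p (R : nat -> nat) :=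
  [/\ R 1 = 1, R 2 = 4 * n, R 3 = 6 * n, R 4 = i
    & [/\ R 6 = z, R 7 = pz, R 8 = p, R 9 = 0 & R 17 = 0]].

Definition loop_state n W i z pz p A B c := exists R M,
  [/\ c = Config 5 R M, reg_rep n i z pz p R, mem_rep n W A B M
    & bounded (8 * n) c].

(** The two instructions common to all cases. The bound on [i] keeps the input address below the
    tables. *)
Lemma exec_token n W i z pz p A B T c Q : i < 4 * n ->
  loop_state n W i z pz p A B c ->
  (forall R M, reg_rep n i.+1 z pz p R -> R 5 = nth 0 W i -> mem_rep n W A B M ->
     bounded (8 * n) (Config 7 R M) -> reaches prog (8 * n) T (Config 7 R M) Q) ->
  reaches prog (8 * n) T.+2 c Q.
Proof.
move=> i_lt [R [M [-> [R1 R2 R3 R4 [R6 R7 R8 R9 R17]] mem bc]]] H.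
apply: (exec_read (r := 5) (a := 4) (v := nth 0 W i) bc) => // [|{}bc].
  by case: mem => _ _ mW; rewrite R4 mW.
apply: (exec_add (r := 4) (a := 4) (b := 1) (v := i.+1) bc) => // [||{}bc].
- by rewrite /upd /= R4 R1 addn1.
- lia.
by apply: H => //; split=> //; split.
Qed.

Lemma exec_set_z n W i z pz p A B R M x : R 5 = x ->
  bounded (8 * n) (Config 56 R M) -> reg_rep n i z pz p R ->
  mem_rep n W A B M -> x <= n ->
  reaches prog (8 * n) 2 (Config 56 R M) (loop_state n W i x pz p A B).
Proof.
move=> R5 bc [R1 R2 R3 R4 [R6 R7 R8 R9 R17]] mem xn.
apply: (exec_add (r := 6) (a := 5) (b := 9) (v := x) bc) => // [||{}bc].
- by rewrite R5 R9 addn0.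
- lia.
apply: (exec_goto bc) => // {}bc.
apply: reaches_now => //; eexists; eexists; split=> //.
Qed.

Section Token.

Variables (n : nat) (W : seq nat) (i z pz p : nat) (A B : nat -> nat).
Hypotheses (n0 : 0 < n) (i_lt : i < 4 * n).

(** The bound 40 is shared by all four kinds of tokens; the longest path, with a double insertion,
    takes 36 steps. *)
Lemma exec_close c : z != 0 -> nth 0 W i = 0 -> loop_state n W i z pz p A B c ->
  reaches prog (8 * n) 40 c (loop_state n W i.+1 0 pz p A B).
Proof.
move=> z0 Wi st; apply: (exec_token i_lt st).
move=> R M [R1 R2 R3 R4 [R6 R7 R8 R9 R17]] R5 mem bc; rewrite Wi in R5.
apply: (exec_jump_eq (k' := 58) bc) => // [|{}bc]; first by rewrite R5 R9.
apply: (exec_jump_eq (k' := 59) bc) => // [|{}bc].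
  by rewrite R6 R9 (negPf z0).
apply: (exec_add (r := 6) (a := 9) (b := 9) (v := 0) bc) => // [|{}bc].
  by rewrite R9.
apply: (exec_goto bc) => // {}bc.
apply: reaches_now => //; eexists; eexists; split=> //.
Qed.

Lemma exec_start c x : z = 0 -> nth 0 W i = x -> 0 < x <= n -> B 0 <= n ->
  loop_state n W i z pz p A B c ->
  reaches prog (8 * n) 40 c
    (loop_state n W i.+1 x pz p (ins A (B 0) x) (ins B 0 x)).
Proof.
move=> z0 Wi /andP[x0 xn] B0 st; apply: (exec_token i_lt st).
move=> R M [R1 R2 R3 R4 [R6 R7 R8 R9 R17]] R5 mem bc; rewrite Wi in R5.
apply: (exec_jump_eq (k' := 8) bc) => // [|{}bc].
  by rewrite R5 R9 eqn0Ngt x0.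
apply: (exec_jump_eq (k' := 45) bc) => // [|{}bc]; first by rewrite R6 z0 R9.
(* The base address of the second table is the cell of [B] at 0. *)
apply: (exec_read (r := 16) (a := 3) (v := B 0) bc) => // [|{}bc].
  by case: mem => _ mB _; rewrite R3 -mB // addn0.
apply: (@reaches_trans _ _ 5 30) => //.
  by apply: (exec_insertA (w := 16) (p := 5) n0 _ _ _ bc _ _ _ mem);
    rewrite /upd /= ?R5 // => -[|[|[|[|[|]]]]].
move=> c' [R' [M' [Ec {}bc fr {}mem]]]; subst c'.
apply: (@reaches_trans _ _ 5 20) => //.
  by apply: (exec_insertB (w := 9) (p := 5) n0 _ _ _ bc _ _ _ mem);
    rewrite ?fr /upd /= ?R5 ?R9 // => -[|[|[|[|[|]]]]].
move=> c' [R'' [M'' [Ec {}bc fr' {}mem]]]; subst c'.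
apply: (@reaches_leq _ _ 2) => //.
apply: exec_set_z (bc) _ _ _ => //.
- by rewrite fr' // fr.
- by split; [..|split]; rewrite fr' // fr.
- by move: mem; rewrite !fr // /upd /= R5 R9.
Qed.

Lemma exec_pend c x : z != 0 -> p = 0 -> nth 0 W i = x -> 0 < x <= n -> z <= n ->
  loop_state n W i z pz p A B c ->
  reaches prog (8 * n) 40 c (loop_state n W i.+1 x z x A B).
Proof.
move=> z0 p0 Wi /andP[x0 xn] zn st; apply: (exec_token i_lt st).
move=> R M [R1 R2 R3 R4 [R6 R7 R8 R9 R17]] R5 mem bc; rewrite Wi in R5.
apply: (exec_jump_eq (k' := 8) bc) => // [|{}bc].
  by rewrite R5 R9 eqn0Ngt x0.
apply: (exec_jump_eq (k' := 9) bc) => // [|{}bc].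
  by rewrite R6 R9 (negPf z0).
apply: (exec_jump_eq (k' := 42) bc) => // [|{}bc]; first by rewrite R8 p0 R9.
apply: (exec_add (r := 7) (a := 6) (b := 9) (v := z) bc) => // [||{}bc].
- by rewrite R6 R9 addn0.
- lia.
apply: (exec_add (r := 8) (a := 5) (b := 9) (v := x) bc) => // [||{}bc].
- by rewrite /upd /= R5 R9 addn0.
- lia.
apply: (exec_goto bc) => // {}bc.
apply: (@reaches_leq _ _ 2) => //.
by apply: exec_set_z (bc) _ _ _.
Qed.

(** The values [z1], [p1], [q1] merge two cases: if the last point read is the waiting one, both
    points go after [pz] with their roles exchanged, as in [pending_factor_op']. *)
Lemma exec_next c x : z != 0 -> p != 0 -> nth 0 W i = x -> 0 < x <= n ->
  z <= n -> p <= n -> pz <= n -> B pz <= n ->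
  loop_state n W i z pz p A B c ->
  let z1 := if z == p then pz else z in
  let p1 := if z == p then x else p in
  let q1 := if z == p then p else x in
  reaches prog (8 * n) 40 c (loop_state n W i.+1 x pz 0
    (ins (ins A (B pz) q1) (B pz) p1) (ins (ins B z1 q1) z1 p1)).
Proof.
move=> z0 p0 Wi /andP[x0 xn] zn pn pzn Bpz st z1 p1 q1.
apply: (exec_token i_lt st).
move=> R M [R1 R2 R3 R4 [R6 R7 R8 R9 R17]] R5 mem bc; rewrite Wi in R5.
apply: (exec_jump_eq (k' := 8) bc) => // [|{}bc].
  by rewrite R5 R9 eqn0Ngt x0.
apply: (exec_jump_eq (k' := 9) bc) => // [|{}bc].
  by rewrite R6 R9 (negPf z0).
apply: (exec_jump_eq (k' := 10) bc) => // [|{}bc].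
  by rewrite R8 R9 (negPf p0).
apply: (exec_add (r := 16) (a := 3) (b := 7) (v := 6 * n + pz) bc) => // [||{}bc].
- by rewrite R3 R7.
- lia.
apply: (exec_read (r := 16) (a := 16) (v := B pz) bc) => // [|{}bc].
  by case: mem => _ mB _; rewrite /upd /= mB.
(* Both branches meet at address 20 with the operands in registers 13 to 16. *)
apply: (@reaches_trans _ _ 5 27 _ _ (fun c => exists R', [/\
  c = Config 20 R' M, bounded (8 * n) c, R' 13 = z1 /\ R' 14 = p1,
  R' 15 = q1 /\ R' 16 = B pz & forall j, (j < 10) || (16 < j) -> R' j = R j])) => //.
  case: (eqVneq z p) @z1 @p1 @q1 => [zp|zp] z1 p1 q1.
    apply: (exec_jump_eq (k' := 17) bc) => // [|{}bc].
      by rewrite /upd /= R6 R8 zp eqxx.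
    apply: (exec_add (r := 13) (a := 7) (b := 9) (v := pz) bc) => // [||{}bc].
    - by rewrite /upd /= R7 R9 addn0.
    - lia.
    apply: (exec_add (r := 14) (a := 5) (b := 9) (v := x) bc) => // [||{}bc].
    - by rewrite /upd /= R5 R9 addn0.
    - lia.
    apply: (exec_add (r := 15) (a := 8) (b := 9) (v := p) bc) => // [||{}bc].
    - by rewrite /upd /= R8 R9 addn0.
    - lia.
    apply: reaches_now => //; eexists; split=> // j j10.
    by rewrite !upd_neq //; lia.
  apply: (exec_jump_eq (k' := 13) bc) => // [|{}bc].
    by rewrite /upd /= R6 R8 (negPf zp).
  apply: (exec_add (r := 13) (a := 6) (b := 9) (v := z) bc) => // [||{}bc].
  - by rewrite /upd /= R6 R9 addn0.
  - lia.
  apply: (exec_add (r := 14) (a := 8) (b := 9) (v := p) bc) => // [||{}bc].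
  - by rewrite /upd /= R8 R9 addn0.
  - lia.
  apply: (exec_add (r := 15) (a := 5) (b := 9) (v := x) bc) => // [||{}bc].
  - by rewrite /upd /= R5 R9 addn0.
  - lia.
  apply: (exec_goto bc) => // {}bc.
  apply: reaches_now => //; eexists; split=> // j j10.
  by rewrite !upd_neq //; lia.
move=> c' [R' [Ec {}bc [R13 R14] [R15 R16] fr]]; subst c'.
apply: (@reaches_trans _ _ 20 7) => //.
  apply: (exec_op n0 bc mem _ _ R13 R14 R15 R16) => //; rewrite ?fr //;
    by rewrite /z1 /p1 /q1; case: ifP.
move=> c' [R'' [M'' [Ec {}bc fr' {}mem]]]; subst c'.
apply: (exec_add (r := 8) (a := 9) (b := 9) (v := 0) bc) => // [|{}bc].
  by rewrite fr' // fr // R9.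
apply: (exec_goto bc) => // {}bc.
apply: (@reaches_leq _ _ 2) => //.
apply: exec_set_z (bc) _ _ _ => //.
  by rewrite /upd /= fr' // fr.
by split; [..|split]; rewrite /upd /= ?fr' // ?fr.
Qed.

End Token.

Lemma drop_consE (W : seq nat) i x t : drop i W = x :: t ->
  [/\ nth 0 W i = x, drop i.+1 W = t & i < size W].
Proof.
move=> E; have iW : i < size W.
  by rewrite ltnNge; apply/negP => /drop_oversize; rewrite E.
by move: E; rewrite (drop_nth 0 iW) => -[-> ->].
Qed.

(** * Reading the whole input *)

Section Loop.

Variables (n : nat) (W : seq nat).
Hypotheses (n0 : 0 < n) (sizeW : size W <= 2 * n).

(** Induction on the unread part [s] of the current cycle; the extra 40 steps pay for its
    terminator. *)
Lemma exec_tail s rest i done c A B z pz p cf :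
  c != [::] -> drop i W = s ++ 0 :: rest ->
  uniq (0 :: flatten done ++ c ++ s) ->
  {in flatten done ++ c ++ s, forall x, x <= n} ->
  loop_inv done c A B z pz p -> loop_state n W i z pz p A B cf ->
  reaches prog (8 * n) (40 * (size s).+1) cf (fun c' => exists A' B' pz' p',
    [/\ loop_inv (rcons done (c ++ s)) [::] A' B' 0 pz' p',
        loop_state n W (i + (size s).+1) 0 pz' p' A' B' c'
      & i + (size s).+1 <= size W /\ drop (i + (size s).+1) W = rest]).
Proof.
elim: s i c A B z pz p cf => [|x s IH] i c A B z pz p cf c0 dropi us bnd inv st.
  have [Wi dropi' iW] := drop_consE dropi.
  have i4 : i < 4 * n by lia.
  (* The last point of the nonempty [c] is not 0, so the program knows that it is inside a cycle. *)
  have z0 : z != 0.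
    have [U [S [_ _ _ [_ ->] _]]] := inv; move: us; rewrite cats0 /= mem_cat negb_or.
    by case: (c) c0 => //= a l _ /andP[/andP[_ n0l] _];
      apply: contraNneq n0l => <-; apply: mem_last.
  have := exec_close i4 z0 Wi st; rewrite muln1 => H.
  apply: reaches_trans H _; first exact: (leqnn (40 + 0)).
  move=> c' st'; apply: reaches_now; first by case: st' => ? [? [-> _ _ ?]].
  by exists A, B, pz, p; rewrite cats0 addn1; split=> //; apply: loop_inv_close inv.
have [Wi dropi' iW] := drop_consE dropi.
have i4 : i < 4 * n by lia.
have xin : x \in flatten done ++ c ++ x :: s by rewrite !mem_cat mem_head !orbT.
have z0 : z != 0.
  have [U [S [_ _ _ [_ ->] _]]] := inv; move: us; rewrite /= !mem_cat !negb_or.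
  by case: (c) c0 => //= a l _ /andP[/and3P[_ n0l _] _];
      apply: contraNneq n0l => <-; apply: mem_last.
have x0n : 0 < x <= n.
  rewrite bnd // andbT lt0n; move: us => /andP[+ _].
  by apply: contraNneq => <-.
have xnew : x \notin 0 :: flatten done ++ c.
  move: us; rewrite catA -cat_cons cat_uniq => /and3P[_ /hasPn/(_ x)].
  by rewrite mem_head => H _; apply: H.
have cx0 : rcons c x != [::] by rewrite -size_eq0 size_rcons.
have [] := loop_inv_bound (n := n) inv.
  move=> y; rewrite mem_cat => yin; apply: bnd; rewrite !mem_cat.
  by case/orP: yin => ->; rewrite ?orbT.
move=> zn pn _ pzn.
have step_case A1 B1 pz1 p1 : loop_inv done (rcons c x) A1 B1 x pz1 p1 ->
    reaches prog (8 * n) 40 cf (loop_state n W i.+1 x pz1 p1 A1 B1) ->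
    reaches prog (8 * n) (40 * (size (x :: s)).+1) cf (fun c' =>
      exists A' B' pz' p',
      [/\ loop_inv (rcons done (c ++ x :: s)) [::] A' B' 0 pz' p',
          loop_state n W (i + (size (x :: s)).+1) 0 pz' p' A' B' c'
        & i + (size (x :: s)).+1 <= size W /\
          drop (i + (size (x :: s)).+1) W = rest]).
  move=> inv1 H; apply: reaches_trans H _ => [|c' st'].
    by rewrite mulnS.
  by rewrite addnS -addSn -cat_rcons; apply: IH inv1 st'; rewrite ?cat_rcons.
case: (eqVneq p 0) inv st => [p0|p0] inv st.
  rewrite p0 in inv st.
  apply: step_case; first exact: loop_inv_pend xnew inv.
  exact: exec_pend st.
have [pzn' Bpzn] := pzn p0.
have := exec_next n0 i4 z0 p0 Wi x0n zn pn pzn' Bpzn st.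
case: (eqVneq z p) inv => [zp|zp] inv; apply: step_case.
  by rewrite zp in inv; apply: loop_inv_op' inv.
exact: loop_inv_op inv.
Qed.

(** Induction on the unread cycles. Each is nonempty: its first point is handled by [exec_start],
    the rest by [exec_tail]. *)
Lemma exec_words ds i done A B pz p cf :
  [::] \notin ds -> i <= size W -> drop i W = flatten [seq rcons d 0 | d <- ds] ->
  uniq (0 :: flatten (done ++ ds)) ->
  {in flatten (done ++ ds), forall x, x <= n} ->
  loop_inv done [::] A B 0 pz p -> loop_state n W i 0 pz p A B cf ->
  reaches prog (8 * n) (40 * size (drop i W)) cf (fun c' => exists A' B' pz' p',
    loop_inv (done ++ ds) [::] A' B' 0 pz' p' /\
    loop_state n W (size W) 0 pz' p' A' B' c').
Proof.
elim: ds i done A B pz p cf => [|d ds IH] i done A B pz p cf nil0 iW dropi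
  us bnd inv st.
  rewrite dropi muln0; apply: reaches_now; first by case: st => ? [? [-> _ _ ?]].
  exists A, B, pz, p; rewrite cats0; split=> //.
  suff -> : size W = i by [].
  have /eqP := congr1 size dropi; rewrite size_drop subn_eq0.
  by move=> /(conj iW)/andP/anti_leq.
have {nil0} [d0 nil0] : d != [::] /\ [::] \notin ds.
  by move: nil0; rewrite inE negb_or eq_sym => /andP.
case: d d0 dropi us bnd => // x s _ dropi us bnd.
have dropi1 : drop i W = x :: s ++ 0 :: flatten [seq rcons d 0 | d <- ds].
  by rewrite dropi /= cat_rcons.
have [Wi dropi2 iW'] := drop_consE dropi1.
have i4 : i < 4 * n by lia.
have fl : flatten (done ++ (x :: s) :: ds) =
    (flatten done ++ [:: x] ++ s) ++ flatten ds.
  by rewrite flatten_cat /= -catA.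
have us1 : uniq (0 :: flatten done ++ [:: x] ++ s).
  by move: us; rewrite fl -cat_cons cat_uniq => /and3P[].
have bnd1 : {in flatten done ++ [:: x] ++ s, forall y, y <= n}.
  by move=> y yin; apply: bnd; rewrite fl mem_cat yin.
have xnew : x \notin 0 :: flatten done.
  move: us1; rewrite -cat_cons cat_uniq => /and3P[_ /hasPn/(_ x)].
  by rewrite mem_head => H _; apply: H.
have x0n : 0 < x <= n.
  rewrite bnd1 ?mem_cat ?mem_head ?orbT // andbT lt0n.
  by apply: contraNneq xnew => ->; rewrite mem_head.
have [] := loop_inv_bound (n := n) inv.
  by move=> y yin; apply: bnd1; rewrite mem_cat; move: yin; rewrite cats0 => ->.
move=> _ _ B0 _.
have st1 := exec_start n0 i4 (erefl 0) Wi x0n B0 st.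
apply: (@reaches_trans _ _ 40
  (40 * (size s).+1 + 40 * size (flatten [seq rcons d 0 | d <- ds])))
  st1 _ => [|c1 st1].
  by rewrite dropi1 /= size_cat /=; lia.
have inv1 := loop_inv_start xnew inv.
apply: reaches_trans (leqnn _) (exec_tail _ dropi2 us1 bnd1 inv1 st1) _ => //.
move=> c2 [A2 [B2 [pz2 [p2 [inv2 st2 [iW2 drop2]]]]]].
rewrite -drop2 -cat_rcons; apply: IH inv2 st2 => //; rewrite cat_rcons //.
Qed.

End Loop.

(** * Initialization, output and total running time *)

(** The output stays below [base], so the writes never disturb the table being followed. *)
Lemma exec_walk P N k b base R M f n l x o :
  (forall j, j < 5 -> nth Halt P (j + k) = nth Halt (walk_code b k) j) -> b < 5 ->
  bounded N (Config k R M) -> R b = base -> R 1 = 1 -> R 9 = 0 -> R 5 = x ->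
  R 17 = o -> x <= n -> all (fun y => 0 < y <= n) l -> fpath f x (rcons l 0) ->
  (forall j, j <= n -> M (base + j) = f j) -> o + size l < base -> base + n <= N ->
  reaches P N (5 * (size l).+1) (Config k R M) (fun c => exists R' M',
    [/\ c = Config (5 + k) R' M', bounded N c,
        R' 5 = 0 /\ R' 17 = o + (size l).+1,
        forall j, (j < 5) || (j == 9) -> R' j = R j
      & (forall j, j <= size l -> M' (o + j) = nth 0 (rcons l 0) j) /\
        (forall j, (j < o) || (o + size l < j) -> M' j = M j)]).
Proof.
move=> code b5; elim: l x o R M => [|y l IH] x o R M bc Rb R1 R9 R5 R17 xn.
(* The first four instructions are the same in both cases of the induction; only the final jump
   tells the end of the cycle from its interior. *)
all: move=> /= ln /andP[/eqP fx pth] memf ol bN.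
all: have ne r : 5 <= r -> (b == r) = false by move=> *; apply/eqP; lia.
all: rewrite mulnS; apply: (exec_add (v := base + x) bc (code 0 isT)) => //= [||{}bc];
  [by rewrite Rb R5 | lia |].
all: apply: (exec_read (v := f x) bc (code 1 isT)) => [|{}bc];
  [by rewrite /upd /= memf |].
all: apply: (exec_write (u := o) (v := f x) bc (code 2 isT)) => // {}bc.
all: apply: (exec_add (v := o.+1) bc (code 3 isT)) => [||{}bc];
  [by rewrite /upd /= R17 R1 addn1 | lia |].
  apply: (exec_jump_lt (k' := 5 + k) bc (code 4 isT)) => [|{}bc].
    by rewrite /upd /= R9 fx.
  apply: reaches_now => //; eexists; eexists; split=> //.
  - by rewrite /upd /= addn1.
  - by move=> j jr; rewrite !upd_neq //; apply/eqP; lia.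
  split=> [[|//] _|j jr]; first by rewrite addn0 /upd eqxx.
  by rewrite !upd_neq //; apply/eqP; lia.
case/andP: ln => /andP[y0 yn] ln.
apply: (exec_jump_lt (k' := k) bc (code 4 isT)) => [|{}bc].
  by rewrite /upd /= R9 fx y0.
apply: reaches_trans (eq_leq (addn0 _))
  (IH y o.+1 _ _ bc _ _ _ _ _ _ _ _ _ _ _) _ => //.
- by rewrite !upd_neq //; apply/eqP; lia.
- by move=> j jn; rewrite upd_neq ?memf //; apply/eqP; lia.
- lia.
move=> c [R' [M' [-> bc' [R'5 R'17] fr [out frM]]]].
apply: reaches_now => //; exists R', M'; split=> //.
- by rewrite R'17 addSnnS.
- by move=> j jr; rewrite fr // !upd_neq //; apply/eqP; lia.
split=> [[|j] jl|j jr]; first by rewrite frM ?addn0 ?ltnSn // /upd eqxx fx.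
  by rewrite -addSnnS out.
by rewrite frM ?upd_neq //; [apply/eqP|]; lia.
Qed.

(** The tables lie beyond the input, so they start out zero, and the zero function is the cycle on
    the dummy point alone. *)
Lemma exec_init n (w : seq nat) : 0 < n -> size w <= 2 * n -> all (leq^~ n) w ->
  reaches prog (8 * n) 5 (init_config n w)
    (loop_state n w 0 0 0 0 (fun=> 0) (fun=> 0)).
Proof.
move=> n0 sw /all_nthP wn; rewrite /init_config.
have bc : bounded (8 * n) (Config 0 (upd (fun=> 0) 0 n) (nth 0 w)).
  split=> j /=; first by rewrite /upd; case: eqP => _; lia.
  have [jw|jw] := ltnP j (size w); last by rewrite nth_default.
  by apply: leq_trans (wn 0 j jw) _; lia.
apply: (exec_const (r := 1) (v := 1) bc) => // [|{}bc]; first lia.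
apply: (exec_add (r := 2) (a := 0) (b := 0) (v := 2 * n) bc) => // [||{}bc].
- by rewrite /upd /=; lia.
- lia.
apply: (exec_add (r := 2) (a := 2) (b := 2) (v := 4 * n) bc) => // [||{}bc].
- by rewrite /upd /=; lia.
- lia.
apply: (exec_add (r := 3) (a := 2) (b := 0) (v := 5 * n) bc) => // [||{}bc].
- by rewrite /upd /=; lia.
- lia.
apply: (exec_add (r := 3) (a := 3) (b := 0) (v := 6 * n) bc) => // [||{}bc].
- by rewrite /upd /=; lia.
- lia.
apply: reaches_now => //; eexists; eexists; split=> //.
by split=> // j jn; rewrite nth_default //; lia.
Qed.

(** Four steps lead from the end mark to address 61, and each walk makes [n + 1] rounds of five
    steps. *)
Lemma exec_output n W i pz p A B c la lb : 0 < n -> size la = n -> size lb = n ->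
  i < 4 * n -> nth 0 W i = 0 ->
  all (fun y => 0 < y <= n) la -> all (fun y => 0 < y <= n) lb ->
  fcycle A (0 :: la) -> fcycle B (0 :: lb) ->
  loop_state n W i 0 pz p A B c ->
  reaches prog (8 * n) (4 + 10 * n.+1) c (fun c' => halted prog c' /\
    output c' (rcons la 0 ++ rcons lb 0)).
Proof.
move=> n0 sla slb i4 Wi lan lbn fA fB st; apply: (exec_token i4 st).
move=> R M [R1 R2 R3 R4 [R6 R7 R8 R9 R17]] R5 mem bc; rewrite Wi in R5.
apply: (exec_jump_eq (k' := 58) bc) => // [|{}bc]; first by rewrite R5 R9.
apply: (exec_jump_eq (k' := 61) bc) => // [|{}bc]; first by rewrite R6 R9.
have [memA memB _] := mem.
have code k b : k \in [:: 61; 66] -> b = (if k == 61 then 2 else 3) ->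
    forall j, j < 5 -> nth Halt prog (j + k) = nth Halt (walk_code b k) j.
  by rewrite !inE => /orP[]/eqP-> -> [|[|[|[|[|]]]]].
have ltA : 0 + size la < 4 * n by lia.
have leA : 4 * n + n <= 8 * n by lia.
have ltB : n.+1 + size lb < 6 * n by lia.
have leB : 6 * n + n <= 8 * n by lia.
(* The end mark just read leaves 0 in register 5, which is where the walk has to start; the first
   walk ends with 0 there again, ready for the second. *)
have walkA := exec_walk (code 61 2 isT (erefl _)) isT bc R2 R1 R9 R5 R17
  (leq0n n) lan fA memA ltA leA.
apply: (reaches_trans (T2 := 5 * n.+1) _ walkA) => [|c1]; first by rewrite sla; lia.
move=> [R' [M' [-> {}bc [R'5 R'17] fr [outA frM]]]].
rewrite sla add0n in R'17 outA frM.
have memB' j : j <= n -> M' (6 * n + j) = B j.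
  by move=> jn; rewrite frM ?memB //; lia.
have [R'3 R'1 R'9] : [/\ R' 3 = 6 * n, R' 1 = 1 & R' 9 = 0] by rewrite !fr.
have walkB := exec_walk (code 66 3 isT (erefl _)) isT bc R'3 R'1 R'9 R'5 R'17
  (leq0n n) lbn fB memB' ltB leB.
rewrite slb in walkB; apply: (reaches_trans (eq_leq (addn0 _)) walkB) => c2.
move=> [R'' [M'' [-> {}bc _ _ [outB frM']]]].
apply: reaches_now => //; split=> // j.
rewrite size_cat !size_rcons sla slb nth_cat size_rcons sla /= => jn.
case: ltnP => jn'; first by rewrite frM' ?jn' // -outA.
by rewrite -outB ?subnKC //; lia.
Qed.

Lemma word_points n (cs : seq (seq 'I_n)) :
  word cs = flatten [seq rcons d 0 | d <- [seq [seq point x | x <- c] | c <- cs]].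
Proof. by rewrite -map_comp. Qed.

(** A nonempty cycle of length [a] takes [a + 1] cells, hence at most [2 * a]. *)
Lemma size_word n (cs : seq (seq 'I_n)) : [::] \notin cs ->
  size (word cs) <= 2 * size (flatten cs).
Proof.
elim: cs => // c cs IH; rewrite inE negb_or eq_sym -size_eq0 => /andP[c0 /IH].
rewrite -[c :: cs]cat1s flatten_cat /word map_cat flatten_cat !size_cat.
rewrite size_rcons size_map; move: (size c) c0 (size (flatten cs)) => a a0 d.
by move: (size (flatten _)) => b /=; lia.
Qed.

(** The time is at most [5 + 40 * (2 * n) + 4 + 10 * (n + 1)], which is below [110 * n] for positive
    [n]. The largest address is 7n, within the bound 8n. *)
Lemma exec_prog n (s : {perm 'I_n}) (cs : seq (seq 'I_n)) : 0 < n ->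
  s \in ('Alt_('I_n))%g -> cycle_notation cs s ->
  reaches prog (8 * n) (110 * n) (init_config n (word cs)) (fun c =>
    halted prog c /\ exists sa sb : seq 'I_n,
      [/\ perm_eq sa (enum 'I_n), perm_eq sb (enum 'I_n),
          forall x, s x = next sa (next sb x)
        & output c (word [:: sa] ++ word [:: sb])]).
Proof.
move=> n0 sA cn; have [P nilcs _] := cn.
set ds := [seq [seq point x | x <- c] | c <- cs].
have sw : size (word cs) <= 2 * n.
  by have := size_word nilcs; rewrite (perm_size P) size_enum_ord.
have Pds : perm_eq (flatten ds) (iota 1 n).
  by rewrite -map_flatten -map_point_enum perm_map.
have bnd : {in flatten ds, forall x, x <= n}.
  by move=> x; rewrite (perm_mem Pds) mem_iota add1n ltnS => /andP[].
have wn : all (leq^~ n) (word cs).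
  apply/allP => x; rewrite word_points => /flattenP[d' /mapP[d dds ->]].
  rewrite mem_rcons inE => /orP[/eqP->//|xd]; apply: bnd.
  by apply/flattenP; exists d.
apply: (@reaches_trans _ _ 5 (105 * n)) (exec_init n0 sw wn) _; first lia.
move=> c st.
have us : uniq (0 :: flatten ([::] ++ ds)).
  by rewrite /= (perm_uniq Pds) iota_uniq (perm_mem Pds) mem_iota.
have nilds : [::] \notin ds.
  apply/mapP => -[c' ccs /(congr1 size)/eqP].
  rewrite size_map eq_sym size_eq0 => /eqP c'0.
  by rewrite -c'0 ccs in nilcs.
have := exec_words n0 sw nilds (leq0n _) _ us bnd (loop_inv_init 0) st.
rewrite drop0 => /(_ (word_points _)) H.
apply: (@reaches_trans _ _ (40 * size (word cs)) (4 + 10 * n.+1)) H _; first lia.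
move=> c1 [A [B [pz [p [inv st1]]]]].
have [sa [sb [Pa Pb fA fB E]]] := loop_inv_final sA cn inv.
have szp (t : seq 'I_n) : perm_eq t (enum 'I_n) -> size [seq point x | x <- t] = n.
  by move=> Pt; rewrite size_map (perm_size Pt) size_enum_ord.
have bp (t : seq 'I_n) : all (fun y => 0 < y <= n) [seq point x | x <- t].
  by apply/allP => _ /mapP[x _ ->]; exact: ltn_ord.
have out := exec_output n0 (szp _ Pa) (szp _ Pb) _ _ (bp _) (bp _) fA fB st1.
apply: reaches_imp (out _ _) => [c2 [hc2 oc2]||]; first last.
- by rewrite nth_default.
- lia.
split=> //; exists sa, sb; split=> //.
by rewrite !word_points /= !cats0.
Qed.

Theorem theorem1 :
  (exists (P : program) (C K : nat),
     forall n : nat, 0 < n ->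
     forall (sigma : {perm 'I_n}) (cs : seq (seq 'I_n)),
       sigma \in ('Alt_('I_n))%g -> cycle_notation cs sigma ->
       exists c' : config,
         halts_within P (C * n) (K * n) (init_config n (word cs)) c' /\
         exists (lambda1 lambda2 : {perm 'I_n}) (cs1 cs2 : seq (seq 'I_n)),
           [/\ is_kcycle n lambda1,
               is_kcycle n lambda2,
               (forall x, sigma x = lambda1 (lambda2 x)),
               cycle_notation cs1 lambda1 /\ cycle_notation cs2 lambda2
             & output c' (word cs1 ++ word cs2)])
  /\
  (forall n : nat, 0 < n ->
   forall sigma : {perm 'I_n}, sigma \in ('Alt_('I_n))%g ->
     exists lambda1 lambda2 : {perm 'I_n},
       [/\ is_kcycle n lambda1,
           is_kcycle n lambda2
         & forall x, sigma x = lambda1 (lambda2 x)]).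
Proof.
have main n (s : {perm 'I_n}) cs : 0 < n -> s \in ('Alt_('I_n))%g ->
    cycle_notation cs s ->
    exists c', halts_within prog (110 * n) (8 * n) (init_config n (word cs)) c' /\
      exists (lambda1 lambda2 : {perm 'I_n}) (cs1 cs2 : seq (seq 'I_n)),
           [/\ is_kcycle n lambda1,
               is_kcycle n lambda2,
               (forall x, s x = lambda1 (lambda2 x)),
               cycle_notation cs1 lambda1 /\ cycle_notation cs2 lambda2
             & output c' (word cs1 ++ word cs2)].
  move=> n0 sA cn.
  have [t [tT bt [ht [sa [sb [Pa Pb E out]]]]]] := exec_prog n0 sA cn.
  have ua : uniq sa by rewrite (perm_uniq Pa) enum_uniq.
  have ub : uniq sb by rewrite (perm_uniq Pb) enum_uniq.
  have [ka na] := perm_of_cycle_notation ua n0 Pa.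
  have [kb nb] := perm_of_cycle_notation ub n0 Pb.
  eexists; split; first by exists t.
  exists (perm_of_cycle ua), (perm_of_cycle ub), [:: sa], [:: sb]; split=> // x.
  by rewrite !permE.
split; first by exists prog, 110, 8 => n n0 s cs; apply: main.
(* The existence statement follows by running the algorithm on any notation of [s]. *)
move=> n n0 s sA; have [cs cn] := cycle_notation_exists s.
have [_ [_ [l1 [l2 [_ [_ [k1 k2 E _ _]]]]]]] := main n s cs n0 sA cn.
by exists l1, l2.
Qed.
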